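(* Let $P$ be a dynamic path with vertices $x_0<\dots<x_n$ (as in the context), and let $k$ be an integer with $1<k<n$ such that at least $k+1$ vertices of $P$ have positive weight. Let $$t=\max\{i:\ 0\le i<n,\ \Theta^1(P_{0,i})<\Theta^{k-1}(P_{i+1,n})\}.$$ Then (a) $0\le t<n$; (b) for all $i\le t$, $\Theta^1(P_{0,i})<\Theta^{k-1}(P_{i+1,n})$; (c) for all $i$ with $t<i<n$, $\Theta^1(P_{0,i})\ge\Theta^{k-1}(P_{i+1,n})$; (d) $\Theta^k(P)=\min\left(\Theta^1(P_{0,t+1}),\ \Theta^{k-1}(P_{t+1,n})\right)$.
   Context: A dynamic path $P$ consists of real points (vertices) $x_0<\dots<x_n$, edges $e_i=(x_{i-1},x_i)$, a constant $\tau>0$ (time to travel unit distance) with every $|x_i-x_j|\tau$ an integer, nonnegative integer weights $w_i$ (people at $x_i$) and positive integer capacities $c_i$ of $e_i$. For $a\le b$, $P_{a,b}$ is the dynamic subpath on vertices $x_a,\dots,x_b$ with the same data; $y\in P_{a,b}$ means $y\in[x_a,x_b]$. Discrete evacuation model on a path $Q$ with sink $y$: everyone moves toward $y$; time is discrete; at each vertex people wait in a FIFO queue to enter the next edge toward $y$; at each integer time step at most $c_i$ people may enter $e_i$, entering as soon as capacity and the queue permit; distance $d$ takes time $d\tau$; people starting at $y$ are evacuated at time $0$. $\Theta(Q,y)$ is the time at which all people of $Q$ have reached $y$, and $\Theta^1(Q)=\min_{y\in Q}\Theta(Q,y)$. For a subpath $Q$ and integer $m\ge1$, $\Theta^m(Q)$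 is the minimum, over all partitions of $Q$ into at most $m$ nonempty consecutive subpaths $Q_1,\dots,Q_{m'}$ ($m'\le m$) and sinks $y_j\in Q_j$, of $\max_j\Theta(Q_j,y_j)$ (this equals the minimum over partitions into exactly $m$ subpaths whenever $Q$ has at least $m$ vertices). *)

(* Defs.v *)
From HB Require Import structures.
From mathcomp Require Import all_boot all_order all_algebra.
From mathcomp Require Import all_classical all_reals.

Set Implicit Arguments.
Unset Strict Implicit.
Unset Printing Implicit Defensive.

Import Order.TTheory GRing.Theory Num.Theory.

Local Open Scope classical_set_scope.
Local Open Scope ring_scope.

(* Vertices are x_0 < ... < x_n and [capacity i] belongs to the edge
   (x_(i-1), x_i) for 1 <= i <= n; values at larger indices are irrelevant. *)
Record dynamic_path (R : realType) (n : nat) := DynamicPath {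
  vertex : nat -> R;
  tau : R;
  weight : nat -> nat;
  capacity : nat -> nat;
  vertex_lt : forall i j, (i < j <= n)%N -> vertex i < vertex j;
  tau_gt0 : 0 < tau;
  travel_int : forall i j, (i <= n)%N -> (j <= n)%N ->
    `|vertex i - vertex j| * tau \is a Num.int;
  capacity_gt0 : forall i, (0 < i <= n)%N -> (0 < capacity i)%N
}.

(* (i, j) is the j-th person starting at x_i, where j < weight i. *)
Definition person : Type := (nat * nat)%type.

(* FIFO queue at a vertex at time s, after the arrivals of time s and before
   the entries of time s: [init] are the people present initially, [arr s]
   those arriving at time s, and the first [c] in line leave at every step. *)
Fixpoint queue (init : seq person) (c : nat) (arr : nat -> seq person)
    (s : nat) : seq person :=
  if s is s'.+1 then drop c (queue init c arr s') ++ arr s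
  else init ++ arr 0%N.

Definition delay (d : nat) (f : nat -> seq person) (s : nat) : seq person :=
  if (d <= s)%N then f (s - d)%N else [::].

Section Evacuation.
Variables (R : realType) (n : nat) (P : dynamic_path R n).

Local Notation x := (vertex P).

Definition group (i : nat) : seq person :=
  [seq (i, j) | j <- iota 0 (weight P i)].

(* The travel time between two vertices is an integer, so that [Num.truncn]
   is only a cast to [nat]. *)
Definition travel (i j : nat) : nat := Num.truncn (`|x i - x j| * tau P).

(* [entering r m s] are the people who, at time s, enter the edge from the
   m-th to the (m+1)-st vertex of the route [r], when everybody moves along
   the consecutive vertices r 0, r 1, ...; the edge joining two consecutive
   vertices bears the larger of their two indices. *)
Fixpoint entering (r : nat -> nat) (m : nat) : nat -> seq person :=
  let c := capacity P (maxn (r m) (r m.+1)) in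
  let arr := if m is m'.+1 then delay (travel (r m') (r m)) (entering r m')
             else fun=> [::] in
  fun s => take c (queue (group (r m)) c arr s).

(* Going from x_i to the neighbouring x_j, one reaches y after x_i. *)
Definition sink_ahead (i j : nat) (y : R) : bool :=
  (x i < y <= x j) || (x j <= y < x i).

(* By time T, p has reached y along the first N edges of [r]: p enters, at an
   integer time s, the edge on which y is met, and then still has to travel
   from its tail to y. *)
Definition reached_along (r : nat -> nat) (N : nat) (y T : R) (p : person) :=
  exists m s, [/\ (m < N)%N, sink_ahead (r m) (r m.+1) y,
    p \in entering r m s & s%:R + `|y - x (r m)| * tau P <= T].

(* In P_(a,b), the people on the left of y follow x_a, x_(a+1), ... and those
   on its right follow x_b, x_(b-1), ...; if y is interior to an edge, the two
   streams use its two disjoint parts, each with the capacity of the edge. *)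
Definition reached (a b : nat) (y T : R) (p : person) : Prop :=
  [\/ x p.1 = y,
      reached_along (fun m => a + m)%N (b - a) y T p |
      reached_along (fun m => b - m)%N (b - a) y T p].

(* The time at which everybody of P_(a,b) has reached y: people starting at y
   are evacuated at time 0, and so is a path without people.  For indices
   a <= b <= n and sinks y in P_(a,b), the infima here and below are minima:
   arrival times are finite, and the evacuation time is lower semicontinuous
   in y on [x_a, x_b]. *)
Definition Theta (a b : nat) (y : R) : R :=
  inf [set T | 0 <= T /\ forall i j, (a <= i <= b)%N ->
                           (j < weight P i)%N -> reached a b y T (i, j)].

Definition Theta1 (a b : nat) : R :=
  inf [set Theta a b y | y in [set y | x a <= y <= x b]].

(* P_(a,b) is split into m' nonempty consecutive subpaths, the j-th of which
   has the vertices of indices l j, ..., l (j+1) - 1 and the sink y j. *)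
Definition sinked_partition (a b m' : nat) (l : nat -> nat) (y : nat -> R) :=
  [/\ l 0%N = a, l m' = b.+1 &
      forall j, (j < m')%N ->
        (l j < l j.+1)%N /\ x (l j) <= y j <= x (l j.+1).-1].

(* The default 0 of the maximum is harmless, as evacuation times are
   nonnegative. *)
Definition Thetam (m a b : nat) : R :=
  inf [set v | exists m' l y, [/\ (0 < m' <= m)%N, sinked_partition a b m' l y &
         v = \big[Num.max/0]_(j < m') Theta (l j) (l j.+1).-1 (y j)]].

Lemma Theta_ge0 a b y : 0 <= Theta a b y.
Proof.
rewrite /Theta; set S := [set T | _].
have [S0|/set0P S0] := eqVneq S set0; first by rewrite S0 inf0.
by apply: lb_le_inf => // T [].
Qed.

Lemma Thetam1 a b : (a <= b)%N -> Thetam 1 a b = Theta1 a b.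
Proof.
move=> leab; rewrite /Thetam /Theta1; congr inf; apply/seteqP; split => v /=.
  move=> [[|[|m']] [l [y [// _ [l0 l1 H] ->]]]].
  have [_] := H 0%N isT; rewrite l0 l1 /= => Hy.
  exists (y 0%N) => //.
  by rewrite big_ord_recl big_ord0 /= l0 l1 /= max_l // Theta_ge0.
move=> [y Hy <-]; exists 1%N, (fun j => if j is 0%N then a else b.+1), (fun=> y).
split => //; last by rewrite big_ord_recl big_ord0 /= max_l // Theta_ge0.
by split => // -[].
Qed.

End Evacuation.

(* Main.v *)
(* People queue at a vertex in the order of their distance to it, so removing
   those of an end vertex of a path delays or advances nobody else.  Hence
   evacuation times decrease when an end vertex is dropped (moving the sink to
   the new end if it was on the lost edge): Theta1 P 0 i increases and
   Thetam P k.-1 i.+1 n decreases with i, so the condition defining t holds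
   exactly up to t, and the best first cut is after x_t or x_(t+1) (no cut at
   all, when t + 1 = n).  The condition holds at i = 0: by the pigeonhole
   principle, one of the at most k - 1 parts of P_(1,n) has two vertices with
   people, which are at least one time unit apart, so that one of them is at
   least half a unit away from any sink, while Theta1 P 0 0 = 0. *)

Require Import Defs.
From HB Require Import structures.
From mathcomp Require Import all_boot all_order all_algebra.
From mathcomp Require Import all_classical all_reals zify lra.

Set Implicit Arguments.
Unset Strict Implicit.
Unset Printing Implicit Defensive.

Import Order.TTheory GRing.Theory Num.Theory.

Local Open Scope ring_scope.

(** * FIFO queues *)

Lemma mem_queue (init : seq person) c arr s p : p \in queue init c arr s ->
  p \in init \/ exists2 s', (s' <= s)%N & p \in arr s'.
Proof.
elim: s => [|s IHs] /=; rewrite mem_cat => /orP[].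
- by left.
- by right; exists 0%N.
- by move=> /mem_drop/IHs [|[s' les' Hp]]; [left|right; exists s' => //; exact: leqW].
- by right; exists s.+1.
Qed.

(** Each step serves [c > 0] of those at the head and newcomers line up behind, so the position of
    [p] decreases until it is below [c]; the induction is on this position. *)
Lemma queue_leaves (init : seq person) c arr s p : (0 < c)%N ->
  p \in queue init c arr s -> exists s', p \in take c (queue init c arr s').
Proof.
move=> c0; move: {2}(index p _) (leqnn (index p (queue init c arr s))) => N.
elim: N s => [|N IHN] s leN Hp.
  by exists s; rewrite in_take // (leq_ltn_trans leN).
have [ltc|lec] := ltnP (index p (queue init c arr s)) c.
  by exists s; rewrite in_take.
have Npt : p \notin take c (queue init c arr s) by rewrite in_take // -leqNgt.
have Hd : p \in drop c (queue init c arr s).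
  by move: Hp; rewrite -{1}(cat_take_drop c (queue init c arr s)) mem_cat (negPf Npt).
apply: (IHN s.+1); last by rewrite /= mem_cat Hd.
rewrite /= index_cat Hd; move: leN (lec).
rewrite -{1 2}(cat_take_drop c (queue init c arr s)) index_cat (negPf Npt).
rewrite size_takel; last by rewrite ltnW // (leq_ltn_trans lec) // index_mem.
by move=> leN _; rewrite -ltnS (leq_trans _ leN) // -add1n leq_add2r.
Qed.

Lemma delay_mem d (f : nat -> seq person) s p :
  p \in delay d f s -> exists2 s', (s' + d)%N = s & p \in f s'.
Proof.
by rewrite /delay; case: leqP => // led Hp; exists (s - d)%N; rewrite ?subnK.
Qed.

(* The stream [f] is [f'] followed by members of [E], who start to come only
   when [f'] is over. *)
Definition tailed (E : pred person) (f f' : nat -> seq person) :=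
  exists e, forall s, [/\ f s = f' s ++ e s, all E (e s) &
    e s != [::] -> forall s', (s < s')%N -> f' s' = [::]].

Lemma tailed_delay E d f f' : tailed E f f' -> tailed E (delay d f) (delay d f').
Proof.
move=> [e He]; exists (delay d e) => s; rewrite /delay.
case: leqP => // led; have [-> Ee e0] := He (s - d)%N; split => // /e0 f'0 s' lts'.
by case: leqP => // led'; apply: f'0; rewrite ltn_sub2r // (leq_ltn_trans led).
Qed.

(** Under FIFO the tail stays behind the others: it uses only the capacity that they leave, and it
    starts to enter only when none of them will follow. *)
Lemma tailed_queue E init c f f' : tailed E f f' ->
  tailed E (fun s => take c (queue init c f s))
           (fun s => take c (queue init c f' s)).
Proof.
move=> [e He].
have [q Hq] : exists q, forall s, [/\ queue init c f s = queue init c f' s ++ q s,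
    all E (q s) & q s != [::] -> forall s', (s < s')%N -> f' s' = [::]].
  (* Capacity left over by the queue fed by [f'] serves [q], whose newcomers are those of [e]. *)
  pose q := fix q s := if s is s'.+1
    then drop (c - size (queue init c f' s')) (q s') ++ e s'.+1 else e 0%N.
  exists q; elim=> [|s [IH1 IH2 IH3]] /=.
    by have [-> Ee e0] := He 0%N; rewrite catA.
  have [-> Ee e0] := He s.+1; rewrite IH1 drop_cat.
  have Ed k : all E (drop k (q s)) by apply/allP => p /mem_drop; exact: (allP IH2).
  split; last 1 first.
  - move=> H s' lts'.
    have [es0|/e0] := eqVneq (e s.+1) [::]; last exact.
    have [qs0|/IH3] := eqVneq (q s) [::]; last by apply; exact: ltn_trans lts'.
    by move: H; rewrite es0 qs0.
  - have [q0|/IH3 f'0] := eqVneq (q s) [::].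
      rewrite q0 /= cats0; case: ltnP => lec; first by rewrite catA.
      by rewrite [in RHS]drop_oversize.
    rewrite (f'0 s.+1) //= cats0; case: ltnP => [ltc|lec].
      have /eqP-> : (c - size (queue init c f' s) == 0)%N by rewrite subn_eq0 ltnW.
      by rewrite drop0 catA.
    by rewrite [in RHS](drop_oversize lec).
  - by rewrite all_cat Ed.
(* Once [f'] is over and its queue fits into one batch, that queue is empty at all later times. *)
have over s : (forall s', (s < s')%N -> f' s' = [::]) ->
    (size (queue init c f' s) <= c)%N -> forall s', (s < s')%N ->
    queue init c f' s' = [::].
  move=> f'0 lec; elim=> // s' IH; rewrite ltnS leq_eqVlt => /predU1P[<-|lts'] /=.
    by rewrite f'0 // cats0 drop_oversize.
  by rewrite IH //= f'0 // ltnW.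
exists (fun s => take (c - size (queue init c f' s)) (q s)) => s.
have [-> qE q0] := Hq s; split.
- rewrite take_cat; case: ltnP => [ltc|lec]; last by rewrite [in RHS]take_oversize.
  have /eqP-> : (c - size (queue init c f' s) == 0)%N by rewrite subn_eq0 ltnW.
  by rewrite take0 cats0.
- by apply/allP => p /mem_take; exact: (allP qE).
- move=> tq s' lts'; rewrite (over s) //.
  + by apply: q0; apply: contraNneq tq => ->.
  + by rewrite leqNgt; apply: contra tq => ltc; rewrite (eqP (ltnW ltc)) take0.
Qed.

(** * Streams of people along a route *)

Section Streams.
Variables (R : realType) (n : nat) (P : dynamic_path R n).
Implicit Types (r : nat -> nat) (p : person).
Local Notation x := (vertex P).

Lemma mem_group i p : p \in group P i -> p.1 = i.
Proof. by move=> /mapP[j _ ->]. Qed.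

Lemma entering0 r s p : p \in entering P r 0 s -> p.1 = r 0%N.
Proof. by move=> /mem_take/mem_queue[/mem_group//|[]]. Qed.

Lemma enteringS r m s p : p \in entering P r m.+1 s -> p.1 = r m.+1 \/
  exists2 s', (s' + travel P (r m) (r m.+1) <= s)%N & p \in entering P r m s'.
Proof.
move=> /mem_take/mem_queue[/mem_group|[s1 les1 /delay_mem[s2 Es2 Hp]]]; first by left.
by right; exists s2 => //; rewrite Es2.
Qed.

(* The queue at a vertex is ordered by starting vertex, nearest first, so that
   those who start at the end of the route never delay anybody else. *)
Lemma entering_behead r m s p : p.1 != r 0%N -> p \in entering P r m.+1 s ->
  p \in entering P (fun i => r i.+1) m s.
Proof.
move=> Np; suff [e He] : tailed (fun q => q.1 == r 0%N) (entering P r m.+1)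
    (entering P (fun i => r i.+1) m).
  have [-> /allP Ee _] := He s; rewrite mem_cat => /orP[//|/Ee Ep].
  by rewrite Ep in Np.
elim: m {s} => [|m IHm]; apply: tailed_queue; last exact: tailed_delay.
(* Nobody arrives at the first vertex of the shortened route, so the whole stream coming from [r 0]
   is the tail. *)
exists (delay (travel P (r 0%N) (r 1%N)) (entering P r 0)) => s; split=> //.
by apply/allP => q /delay_mem[s' _ /entering0 ->].
Qed.

(** Induction along the route: positive capacities end every wait ([queue_leaves]), and every edge
    takes finite time. *)
Lemma entering_finite r m p :
  (forall i, (i <= m)%N -> (0 < capacity P (maxn (r i) (r i.+1)))%N) ->
  forall i, (i <= m)%N -> p \in group P (r i) -> exists s, p \in entering P r m s.
Proof.
elim: m => [|m IHm] cap i.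
  rewrite leqn0 => /eqP-> Hp; apply: (@queue_leaves _ _ _ 0); first exact: cap.
  by rewrite /= mem_cat Hp.
rewrite leq_eqVlt => /predU1P[->|lei] Hp.
  by apply: (@queue_leaves _ _ _ 0); [exact: cap|rewrite /= mem_cat Hp].
have [j lej|s Hs] := IHm _ i lei Hp; first by apply: cap; exact: leqW.
set d := travel P (r m) (r m.+1).
apply: (@queue_leaves _ _ _ (s + d)); first exact: cap.
have : p \in delay d (entering P r m) (s + d) by rewrite /delay leq_addl addnK.
by rewrite -/d; case: (s + d)%N => [|z] Hz /=; rewrite mem_cat; apply/orP; right.
Qed.

Lemma travelE i j : (i <= n)%N -> (j <= n)%N ->
  (travel P i j)%:R = `|x i - x j| * tau P.
Proof.
move=> lei lej; apply: truncnK.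
by rewrite natrEint travel_int // mulr_ge0 // ltW // tau_gt0.
Qed.

(** Waiting only adds time, and by the triangle inequality the lengths of the edges travelled add up
    to at least the distance. *)
Lemma entering_ge r m s p : (forall i, (i <= m)%N -> (r i <= n)%N) ->
  p \in entering P r m s -> `|x p.1 - x (r m)| * tau P <= s%:R.
Proof.
elim: m s => [|m IHm] s ler.
  by move=> /entering0 ->; rewrite subrr normr0 mul0r.
move=> /enteringS[->|[s' les' Hp]]; first by rewrite subrr normr0 mul0r.
have {}IHm := IHm s' (fun i lei => ler i (leqW lei)) Hp.
have : (s' + travel P (r m) (r m.+1))%:R <= s%:R :> R by rewrite ler_nat.
apply: le_trans; rewrite natrD travelE ?ler //.
apply: le_trans (lerD IHm (lexx _)); rewrite -mulrDl ler_wpM2r ?(ltW (tau_gt0 P)) //.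
exact: ler_distD.
Qed.

End Streams.

(** A discrete intermediate value property; it locates the edge of a route that bears the sink, and
    the part of a partition that contains a vertex. *)
Lemma crossing (Q : pred nat) m N : (m <= N)%N -> ~~ Q m -> Q N ->
  exists2 i, (m <= i < N)%N & ~~ Q i && Q i.+1.
Proof.
elim: N => [|N IHN]; first by rewrite leqn0 => /eqP-> /negPf->.
rewrite leq_eqVlt => /predU1P[-> /negPf->//|lem NQm QN].
have [/(IHN lem NQm)[i /andP[mi iN] Qi]|NQN] := boolP (Q N).
  by exists i => //; rewrite mi ltnW.
by exists N; [rewrite -ltnS lem ltnSn|rewrite NQN].
Qed.

(** * Reaching the sink: finiteness, lower bounds, and dropping an end vertex *)

Section Reached.
Variables (R : realType) (n : nat) (P : dynamic_path R n).
Implicit Types (r : nat -> nat) (p : person) (y T : R).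
Local Notation x := (vertex P).
Local Notation up a := (fun m => a + m)%N.
Local Notation down b := (fun m => b - m)%N.

Lemma vertex_le i j : (i <= j <= n)%N -> x i <= x j.
Proof.
move=> /andP[]; rewrite leq_eqVlt => /predU1P[->//|ltij] lej.
by rewrite ltW // vertex_lt // ltij.
Qed.

Lemma reached_along_le r N y T T' p : T <= T' ->
  reached_along P r N y T p -> reached_along P r N y T' p.
Proof. by move=> leT [m [s [? ? ? /le_trans H]]]; exists m, s; split; auto. Qed.

Lemma reached_le a b y T T' p : T <= T' ->
  reached P a b y T p -> reached P a b y T' p.
Proof.
move=> leT [H|H|H]; [exact: Or31|apply: Or32|apply: Or33];
  exact: reached_along_le H.
Qed.

Lemma reached_along_finite r N y p m i : (i <= m < N)%N ->
  (forall j, (j < N)%N -> (0 < maxn (r j) (r j.+1) <= n)%N) ->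
  sink_ahead P (r m) (r m.+1) y -> p \in group P (r i) ->
  exists T, reached_along P r N y T p.
Proof.
move=> /andP[lei ltm] ler Hy Hp.
have [|s Hs] := entering_finite _ lei Hp.
  by move=> j lej; apply/capacity_gt0/ler/(leq_ltn_trans lej).
by exists (s%:R + `|y - x (r m)| * tau P), m, s.
Qed.

Lemma reached_finite a b y i p : (a <= i <= b)%N -> (b <= n)%N ->
  x a <= y <= x b -> p \in group P i -> exists T, reached P a b y T p.
Proof.
move=> /andP[lea leb] len /andP[ya yb] Hp.
have Ep := mem_group Hp.
have [lty|lty|Ey] := ltgtP (x i) y; last by exists 0; apply: Or31; rewrite Ep.
- have [|||m /andP[lem ltm] /andP[Q1 Q2]] :=
      @crossing (fun m => y <= x (up a m)) (i - a) (b - a).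
  + lia.
  + by rewrite subnKC // -ltNge.
  + by rewrite subnKC // (leq_trans lea).
  have [||||T HT] := @reached_along_finite (up a) (b - a) y p m (i - a).
  + by rewrite lem.
  + by move=> j; lia.
  + by rewrite /sink_ahead ltNge Q1 Q2.
  + by rewrite subnKC.
  by exists T; apply: Or32.
- have [|||m /andP[lem ltm] /andP[Q1 Q2]] :=
      @crossing (fun m => x (down b m) <= y) (b - i) (b - a).
  + lia.
  + by rewrite subKn // -ltNge.
  + by rewrite subKn // (leq_trans lea).
  have [||||T HT] := @reached_along_finite (down b) (b - a) y p m (b - i).
  + by rewrite lem.
  + by move=> j; lia.
  + by rewrite /sink_ahead (ltNge y) Q1 Q2 orbT.
  + by rewrite subKn.
  by exists T; apply: Or33.
Qed.

Lemma reached_along_ge r N y T p : (forall i, (i < N)%N -> (r i <= n)%N) ->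
  reached_along P r N y T p -> `|y - x p.1| * tau P <= T.
Proof.
move=> ler [m [s [ltm _ /entering_ge Hp]]]; apply: le_trans.
apply: le_trans (lerD (Hp _) (lexx _)); last first.
  by move=> i lei; apply: ler; exact: leq_ltn_trans ltm.
rewrite -mulrDl ler_wpM2r ?(ltW (tau_gt0 P)) //.
by rewrite [leRHS]addrC [`|x p.1 - _|]distrC ler_distD.
Qed.

Lemma reached_ge a b y T p : (b <= n)%N -> 0 <= T ->
  reached P a b y T p -> `|y - x p.1| * tau P <= T.
Proof.
move=> len T0 [->||]; first by rewrite subrr normr0 mul0r.
- by apply: reached_along_ge => i; lia.
- by apply: reached_along_ge => i; lia.
Qed.

Lemma reached_along_behead r N y T p : p.1 != r 0%N ->
  reached_along P r N.+1 y T p -> reached_along P (fun i => r i.+1) N y T p.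
Proof.
move=> Np [[|m] [s [ltm Hy Hp leT]]].
  by rewrite (entering0 Hp) eqxx in Np.
by exists m, s; split => //; exact: entering_behead.
Qed.

(* Stopping at the last vertex before the edge that bears the sink. *)
Lemma reached_along_belast r N y T p : (forall i, (i <= N)%N -> (r i <= n)%N) ->
  (forall m, (m < N)%N -> sink_ahead P (r m) (r m.+1) (x (r m.+1))) ->
  (forall m, (m < N)%N -> ~~ sink_ahead P (r m) (r m.+1) y) ->
  reached_along P r N.+1 y T p ->
  x p.1 = x (r N) \/ reached_along P r N (x (r N)) T p.
Proof.
move=> ler Hr Ny [m [s [ltm Hy Hp leT]]].
(* The sink can only be met on the last edge of the route. *)
have Em : m = N.
  by apply/eqP; rewrite eqn_leq -ltnS ltm /= leqNgt; apply: contraL Hy => /Ny.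
move: Hp leT; rewrite {m ltm Hy}Em; case: N => [|N] in ler Hr Ny *.
  by move=> /entering0->; left.
move=> /enteringS[->|[s' les' Hp]] leT; first by left.
(* Entering the last edge at time [s] requires having arrived at its starting vertex by then. *)
right; exists N, s'; split=> //; first exact: Hr.
rewrite distrC -travelE ?ler // -natrD.
have : (s' + travel P (r N) (r N.+1))%:R <= s%:R :> R by rewrite ler_nat.
move=> /le_trans; apply; apply: le_trans leT.
by rewrite lerDl mulr_ge0 // ltW // tau_gt0.
Qed.

(** If [y <= x i], the left stream is unchanged and the right one only loses the people at its start
    ([entering_behead]). If [y] is on the lost edge, everybody who remains comes from the left and
    is at [x i] before reaching [y]. *)
Lemma reached_dropr a i y T p : (a <= i < n)%N -> (a <= p.1 <= i)%N ->
  x a <= y <= x i.+1 -> reached P a i.+1 y T p ->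
  reached P a i (Num.min y (x i)) T p.
Proof.
move=> /andP[lea lti] /andP[lep1 lep2] /andP[ya yi] H.
have Np : p.1 != i.+1 by rewrite neq_ltn ltnS lep2.
have lexp : x p.1 <= x i by apply: vertex_le; lia.
have EN : (i.+1 - a = (i - a).+1)%N by rewrite subSn.
have Er : (fun m => i.+1 - m.+1)%N = down i by apply/funext => m; rewrite subSS.
have [ley|lty] := leP y (x i); case: H => [E|H|H].
- exact: Or31.
- apply: Or32; case: H => m [s [ltm Hy Hp leT]]; exists m, s; split => //.
  (* A sink [y <= x i] is not met on the edge from [x i] up to [x i.+1]. *)
  move: ltm; rewrite EN ltnS leq_eqVlt => /predU1P[Em|//].
  move: Hy; rewrite Em addnS subnKC // /sink_ahead.
  have := @vertex_lt _ _ P i i.+1; rewrite ltnSn => /(_ lti) lt1.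
  by rewrite (ltNge (x i)) ley /= => /andP[/(lt_le_trans lt1)/ltW]; rewrite leNgt => /negPf->.
- by apply: Or33; move: H; rewrite EN -Er; apply: reached_along_behead.
- by move: lty; rewrite -E ltNge lexp.
- have Ei : up a (i - a)%N = i by rewrite subnKC.
  have [||||E|] := @reached_along_belast (up a) (i - a) y T p.
  + by move=> j; lia.
  + by move=> m ltm; rewrite /sink_ahead lexx vertex_lt //; lia.
  + move=> m ltm; have : x (up a m.+1) <= x i by apply: vertex_le; lia.
    have : x (up a m) <= x i by apply: vertex_le; lia.
    by rewrite /sink_ahead => l1 l2; apply/negP => /orP[] /andP[]; lra.
  + by rewrite -EN.
  + by apply: Or31; rewrite E Ei.
  + by rewrite Ei; apply: Or32.
(* From the right, [y > x i] is only met on the first edge, which [p] would enter only when starting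
   at [x i.+1]. *)
- case: H => -[|m] [s [ltm Hy Hp leT]]; first by rewrite (entering0 Hp) subn0 eqxx in Np.
  have l2 : x (down i.+1 m.+1) <= x i by apply: vertex_le; lia.
  have l1 : x (down i.+1 m.+2) <= x i by apply: vertex_le; lia.
  by move: Hy; rewrite /sink_ahead => /orP[] /andP[]; lra.
Qed.

(** Mirror image of [reached_dropr], with the two streams exchanged. *)
Lemma reached_dropl a b y T p : (a < b <= n)%N -> (a < p.1 <= b)%N ->
  x a <= y <= x b -> reached P a b y T p ->
  reached P a.+1 b (Num.max y (x a.+1)) T p.
Proof.
move=> /andP[ltab len] /andP[lep1 lep2] /andP[ya yb] H.
have Np : p.1 != a by rewrite neq_ltn lep1 orbT.
have lexp : x a.+1 <= x p.1 by apply: vertex_le; lia.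
have EN : (b - a = (b - a.+1).+1)%N by lia.
have Er : (fun m => a + m.+1)%N = up a.+1 by apply/funext => m; rewrite addnS.
have Ei : down b (b - a.+1)%N = a.+1 by rewrite subKn.
have Ei' : down b (b - a.+1).+1 = a by lia.
have [lty|ley] := ltP y (x a.+1); case: H => [E|H|H].
- by move: lty; rewrite -E ltNge lexp.
- case: H => -[|m] [s [ltm Hy Hp leT]]; first by rewrite (entering0 Hp) addn0 eqxx in Np.
  have l2 : x a.+1 <= x (up a m.+1) by apply: vertex_le; lia.
  have l1 : x a.+1 <= x (up a m.+2) by apply: vertex_le; lia.
  by move: Hy; rewrite /sink_ahead => /orP[] /andP[]; lra.
- have [||||E|] := @reached_along_belast (down b) (b - a.+1) y T p.
  + by move=> j; lia.
  + by move=> m ltm; apply/orP; right; rewrite lexx vertex_lt //; lia.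
  + move=> m ltm; have : x a.+1 <= x (down b m.+1) by apply: vertex_le; lia.
    have : x a.+1 <= x (down b m) by apply: vertex_le; lia.
    by rewrite /sink_ahead => l1 l2; apply/negP => /orP[] /andP[]; lra.
  + by rewrite -EN.
  + by apply: Or31; rewrite E Ei.
  + by rewrite Ei; apply: Or33.
- exact: Or31.
- apply: Or32; move: H; rewrite EN -Er.
  by apply: reached_along_behead; rewrite addn0.
- apply: Or33; case: H => m [s [ltm Hy Hp leT]]; exists m, s; split => //.
  move: ltm; rewrite EN ltnS leq_eqVlt => /predU1P[Em|//].
  move: Hy; rewrite Em Ei Ei' /sink_ahead.
  have : x a < x a.+1 by apply: vertex_lt; lia.
  by move=> ? /orP[] /andP[]; lra.
Qed.

End Reached.

(** * Evacuation times as infima *)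

Section EvacuationTimes.
Variables (R : realType) (n : nat) (P : dynamic_path R n).
Implicit Types (T v : R) (l : nat -> nat).
Local Notation x := (vertex P).

(** A strict upper bound on an infimum gives a witness whether or not the infimum is attained. The
    set of times must be nonempty, because [inf] of the empty set is 0; [reached_finite] ensures
    this. *)
Lemma Theta_lt a b y v : (b <= n)%N -> x a <= y <= x b ->
  Theta P a b y < v <-> exists2 T, 0 <= T < v &
    forall i j, (a <= i <= b)%N -> (j < weight P i)%N -> reached P a b y T (i, j).
Proof.
move=> len yab; split=> [/inf_lt[]|[T /andP[T0 Tv] HT]].
- have /choice[f Hf] : forall p, exists T, (a <= p.1 <= b)%N ->
      (p.2 < weight P p.1)%N -> reached P a b y T p.
    move=> [i j]; have [Hi|] := boolP (a <= i <= b)%N; last by exists 0.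
    have [Hj|] := boolP (j < weight P i)%N; last by exists 0.
    have [|T HT] := reached_finite Hi len yab (p := (i, j)); last by exists T.
    by apply/mapP; exists j; rewrite // mem_iota.
  (* There are finitely many people, so the maximum of their arrival times suits them all; its
     default 0 keeps it nonnegative. *)
  pose M (i : nat) := \big[Num.max/0]_(j < weight P i) f (i, j : nat).
  exists (\big[Num.max/0]_(i < b.+1) M i); split.
    by apply/bigmax_geP; left.
  move=> i j Hi Hj; apply: reached_le (Hf (i, j) Hi Hj).
  have ltib : (i < b.+1)%N by case/andP: Hi.
  apply: le_trans (le_bigmax 0 (fun i : 'I_b.+1 => M i) (Ordinal ltib)).
  exact: (le_bigmax 0 (fun j' : 'I_(weight P i) => f (i, j' : nat)) (Ordinal Hj)).
- by move=> T [T0 HT] Tv; exists T; rewrite ?T0.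
- by apply: le_lt_trans Tv; apply: ge_inf => //; exists 0 => z [].
Qed.

Lemma Theta1_lt a b v : (a <= b <= n)%N ->
  Theta1 P a b < v <-> exists2 y, x a <= y <= x b & Theta P a b y < v.
Proof.
move=> leab; split=> [/inf_lt[]|[y Hy]].
- by exists (Theta P a b (x a)), (x a); rewrite //= lexx vertex_le.
- by move=> _ [y Hy <-] ltv; exists y.
- apply: le_lt_trans; apply: ge_inf; last by exists y.
  by exists 0 => _ [z _ <-]; exact: Theta_ge0.
Qed.

(** The conjunct [0 < v] reflects the default 0 of the maximum over the parts. *)
Lemma Thetam_lt m a b v : (0 < m)%N -> (a <= b <= n)%N ->
  Thetam P m a b < v <-> 0 < v /\ exists m' l y,
    [/\ (0 < m' <= m)%N, sinked_partition P a b m' l y &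
        forall j, (j < m')%N -> Theta P (l j) (l j.+1).-1 (y j) < v].
Proof.
move=> m0 leab; split=> [/inf_lt[]|[v0 [m' [l [y [lem Hl Hy]]]]]].
(* The undivided path with sink [x a] shows that the set of values is nonempty. *)
- pose l j := if j is 0%N then a else b.+1.
  exists (\big[Num.max/0]_(j < 1) Theta P (l j) (l j.+1).-1 (x a)), 1%N, l, (fun=> x a).
  split=> //; split=> // -[|//] _ /=; rewrite lexx vertex_le //; split=> //.
  by rewrite ltnS; case/andP: leab.
- move=> _ [m' [l [y [lem Hl ->]]]] /bigmax_ltP[v0 Hv]; split=> //.
  by exists m', l, y; split => // j ltj; exact: (Hv (Ordinal ltj)).
- apply: (@le_lt_trans _ _ (\big[Num.max/0]_(j < m') Theta P (l j) (l j.+1).-1 (y j))).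
    apply: ge_inf; last by exists m', l, y.
    by exists 0 => _ [? [? [? [_ _ ->]]]]; apply/bigmax_geP; left.
  by apply/bigmax_ltP; split=> // j _; exact: Hy.
Qed.

(** * Monotonicity under dropping end vertices *)

Lemma Theta_dropr a i y : (a <= i < n)%N -> x a <= y <= x i.+1 ->
  Theta P a i (Num.min y (x i)) <= Theta P a i.+1 y.
Proof.
move=> /andP[lea lti] yai; rewrite leNgt; apply/negP.
move=> /(Theta_lt _ lti yai)[T /andP[T0 TT] HT].
(* Inequalities between infima are proved by refuting the strict converse: a witness for the right
   side would put the left side below itself. *)
suff : Theta P a i (Num.min y (x i)) < Theta P a i (Num.min y (x i)).
  by rewrite ltxx.
apply/Theta_lt; first exact: ltnW.
  have /andP[ya _] := yai.
  by rewrite le_min ya vertex_le ?lea ?(ltnW lti) //= ge_min lexx orbT.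
exists T => [|j w Hj Hw]; first by rewrite T0.
by apply: reached_dropr => //; rewrite ?lea //; apply: HT => //; lia.
Qed.

Lemma Theta_dropl a b y : (a < b <= n)%N -> x a <= y <= x b ->
  Theta P a.+1 b (Num.max y (x a.+1)) <= Theta P a b y.
Proof.
move=> /andP[lta len] yab; rewrite leNgt; apply/negP.
move=> /(Theta_lt _ len yab)[T /andP[T0 TT] HT].
suff : Theta P a.+1 b (Num.max y (x a.+1)) < Theta P a.+1 b (Num.max y (x a.+1)).
  by rewrite ltxx.
apply/Theta_lt => //.
  have /andP[_ yb] := yab.
  by rewrite ge_max yb vertex_le ?lta //= le_max lexx orbT.
exists T => [|j w Hj Hw]; first by rewrite T0.
by apply: reached_dropl => //; rewrite ?lta //; apply: HT => //; lia.
Qed.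

Lemma le_Theta1 a i j : (a <= i <= j)%N -> (j <= n)%N ->
  Theta1 P a i <= Theta1 P a j.
Proof.
move=> /andP[lea]; elim: j => [|j IHj]; first by rewrite leqn0 => /eqP->.
rewrite leq_eqVlt => /predU1P[->//|leij] lejn.
apply: le_trans (IHj leij (ltnW lejn)) _; rewrite leNgt; apply/negP.
have leaj : (a <= j)%N by exact: leq_trans lea leij.
move=> /Theta1_lt[]; first by rewrite leqW.
move=> y Hy lty; suff : Theta1 P a j < Theta1 P a j by rewrite ltxx.
apply/Theta1_lt; first by rewrite leaj ltnW.
exists (Num.min y (x j)); last by apply: le_lt_trans lty; apply: Theta_dropr; rewrite ?leaj.
have /andP[ya _] := Hy.
by rewrite le_min ya vertex_le ?leaj ?(ltnW lejn) //= ge_min lexx orbT.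
Qed.

Lemma sinked_partition_le a b m l y i j : sinked_partition P a b m l y ->
  (i <= j <= m)%N -> (l i <= l j)%N.
Proof.
move=> [_ _ Hl] /andP[]; elim: j => [|j IHj]; first by rewrite leqn0 => /eqP->.
rewrite leq_eqVlt => /predU1P[->//|leij] lejm.
by have [/ltnW/(leq_trans (IHj leij (ltnW lejm)))] := Hl _ lejm.
Qed.

Lemma sinked_partition_behead a b m l y : sinked_partition P a b m.+1 l y ->
  sinked_partition P (l 1%N) b m (fun j => l j.+1) (fun j => y j.+1).
Proof. by move=> [_ lb Hl]; split=> // j ltj; exact: Hl. Qed.

Lemma sinked_partition_cons a i b m l y y0 : (a <= i)%N -> x a <= y0 <= x i ->
  sinked_partition P i.+1 b m l y ->
  sinked_partition P a b m.+1 (fun j => if j is j'.+1 then l j' else a)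
    (fun j => if j is j'.+1 then y j' else y0).
Proof.
move=> lea Hy0 [l0 lm Hl]; split=> // -[|j] ltj; last exact: Hl.
by rewrite l0 ltnS.
Qed.

Lemma Thetam_dropl m a b : (0 < m)%N -> (a < b <= n)%N ->
  Thetam P m a.+1 b <= Thetam P m a b.
Proof.
move=> m0 /andP[lta len]; rewrite leNgt; apply/negP.
have leb : (a.+1 <= b <= n)%N by rewrite lta.
move=> /Thetam_lt[//||v0 [m' [l [y [lem Hl Hy]]]]].
  by rewrite (ltnW lta).
case: m' => [//|m'] in lem Hl Hy *.
suff : Thetam P m a.+1 b < Thetam P m a.+1 b by rewrite ltxx.
apply/Thetam_lt => //; split=> //.
have [l0 lb Hl'] := Hl.
have [l1 Hy0] := Hl' 0%N isT; rewrite l0 in l1 Hy0.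
have Hy1 : Theta P a (l 1%N).-1 (y 0%N) < Thetam P m a.+1 b.
  by have := Hy 0%N isT; rewrite l0.
have lel1 : (l 1%N <= b.+1)%N by rewrite -lb; apply: (sinked_partition_le Hl); lia.
(* If the first part is the vertex [a] alone, it disappears; another part remains because
   [a < b]. *)
move: l1; rewrite leq_eqVlt => /predU1P[E1|lta1].
  case: m' => [|m'] in lem Hl Hy lb Hl' *.
    by move: lb; rewrite -E1 => -[E]; rewrite E ltnn in lta.
  exists m'.+1, (fun j => l j.+1), (fun j => y j.+1); split.
  - by case/andP: lem => _ /ltnW.
  - by rewrite E1; apply: sinked_partition_behead.
  - by move=> j ltj; apply: Hy.
(* Otherwise the first part loses its end [a], and its sink moves to [x a.+1] if it lay before that
   vertex. *)
exists m'.+1, (fun j => if j is 0%N then a.+1 else l j),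
  (fun j => if j is 0%N then Num.max (y 0%N) (x a.+1) else y j).
case El1 : (l 1%N) => [|l1'] in lta1 Hy0 Hy1 lel1 *; first by [].
split=> //.
- split=> // -[|j] ltj /=; last exact: Hl'.
  rewrite El1; split=> //; have /andP[_ yb] := Hy0.
  rewrite ge_max yb /= le_max lexx orbT vertex_le //.
  by rewrite -ltnS lta1 (leq_trans _ len).
- move=> [|j] ltj /=; last exact: Hy.
  by rewrite El1 /=; apply: le_lt_trans Hy1; apply: Theta_dropl => //=; lia.
Qed.

Lemma ge_Thetam m b i j : (0 < m)%N -> (i <= j <= b)%N -> (b <= n)%N ->
  Thetam P m j b <= Thetam P m i b.
Proof.
move=> m0 /andP[]; elim: j => [|j IHj]; first by rewrite leqn0 => /eqP->.
rewrite leq_eqVlt => /predU1P[->//|leij] lejb len.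
by apply: le_trans (IHj leij (ltnW lejb) len); apply: Thetam_dropl; rewrite ?lejb.
Qed.

(** * Cutting off the first part *)

Lemma Thetam_cons m a i b : (0 < m)%N -> (a <= i < b)%N -> (b <= n)%N ->
  Thetam P m.+1 a b <= Num.max (Theta1 P a i) (Thetam P m i.+1 b).
Proof.
move=> m0 /andP[lea ltb] len; rewrite leNgt gt_max; apply/negP => /andP[].
move=> /Theta1_lt[]; first by lia.
move=> y0 Hy0 Th0 /Thetam_lt[//||v0 [m' [l [y [lem Hl Hy]]]]]; first by rewrite ltb.
suff : Thetam P m.+1 a b < Thetam P m.+1 a b by rewrite ltxx.
apply/Thetam_lt => //; first by lia.
split=> //; exists m'.+1; do 2 eexists; split; first by case/andP: lem.
  exact: sinked_partition_cons lea Hy0 Hl.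
by have [l0 _ _] := Hl; move=> [|j] ltj; [rewrite l0|exact: Hy].
Qed.

Lemma Thetam_le1 m a b : (0 < m)%N -> (a <= b <= n)%N ->
  Thetam P m a b <= Theta1 P a b.
Proof.
move=> m0 leab; rewrite -Thetam1; last by case/andP: leab.
rewrite leNgt; apply/negP => /Thetam_lt[//|//|v0 [m' [l [y [lem Hl Hy]]]]].
suff : Thetam P m a b < Thetam P m a b by rewrite ltxx.
by apply/Thetam_lt => //; split=> //; exists m', l, y; split => //; lia.
Qed.

(** The cut is the one after the first part of a partition witnessing the bound; the first
    alternative is the case of a single part. *)
Lemma Thetam_lt_split m a b v : (0 < m)%N -> (a <= b <= n)%N ->
  Thetam P m.+1 a b < v -> Theta1 P a b < v \/
  exists2 i, (a <= i < b)%N & Theta1 P a i < v /\ Thetam P m i.+1 b < v.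
Proof.
move=> m0 leab /Thetam_lt[//|//|v0 [m' [l [y [lem Hl Hy]]]]].
case: m' => [//|m'] in lem Hl Hy *.
have [l0 lb Hl'] := Hl.
have [l1 Hy0] := Hl' 0%N isT; have Th0 := Hy 0%N isT.
rewrite l0 in l1 Hy0 Th0.
have Hy1 j : (j < m')%N -> Theta P (l j.+1) (l j.+2).-1 (y j.+1) < v.
  by move=> ltj; exact: Hy.
case: m' => [|m'] in lem Hl Hy lb Hl' Hy1.
  by left; rewrite lb in Hy0 Th0; apply/Theta1_lt => //; exists (y 0%N).
have lel1 : (l 1%N <= b)%N.
  have [lt12 _] := Hl' 1%N isT; rewrite -ltnS (leq_trans lt12) // -lb.
  by apply: (sinked_partition_le Hl); lia.
right; exists (l 1%N).-1; first by lia.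
split; first by apply/Theta1_lt; [lia|exists (y 0%N)].
apply/Thetam_lt; [by []|by lia|split=> //].
exists m'.+1, (fun j => l j.+1), (fun j => y j.+1); split => //.
rewrite prednK; last exact: leq_ltn_trans l1.
exact: sinked_partition_behead.
Qed.

(** * A positive lower bound by the pigeonhole principle *)

Lemma Theta_ge a b y i j : (b <= n)%N -> x a <= y <= x b ->
  (a <= i < j)%N -> (j <= b)%N -> (0 < weight P i)%N -> (0 < weight P j)%N ->
  2^-1 <= Theta P a b y.
Proof.
move=> len yab /andP[lai ltij] lejb wi wj; rewrite leNgt; apply/negP.
move=> /(Theta_lt _ len yab)[T /andP[T0 TT] HT].
have lain : (i <= n)%N by lia.
have lejn : (j <= n)%N by lia.
have Hi := reached_ge len T0 (HT i 0%N ltac:(lia) wi).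
have Hj := reached_ge len T0 (HT j 0%N ltac:(lia) wj).
(* The travel time between distinct vertices is a positive integer, hence at least 1; this is where
   the constant one half comes from. *)
have : (1 <= travel P i j)%N.
  rewrite -(ltr_nat R) travelE // mulr_gt0 ?tau_gt0 // normr_gt0 subr_eq0.
  by rewrite lt_eqF // vertex_lt // ltij.
rewrite -(ler_nat R) travelE // => H1.
have : `|x i - x j| * tau P <= `|y - x i| * tau P + `|y - x j| * tau P.
  rewrite -mulrDl ler_wpM2r ?(ltW (tau_gt0 P)) //.
  by rewrite [`|y - x i|]distrC ler_distD.
move: Hi Hj => /=; lra.
Qed.

Lemma Thetam_ge m a b (A : {set 'I_n.+1}) : (0 < m)%N -> (a <= b <= n)%N ->
  (forall i : 'I_n.+1, i \in A -> (a <= i <= b)%N /\ (0 < weight P i)%N) ->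
  (m < #|A|)%N -> 2^-1 <= Thetam P m a b.
Proof.
move=> m0 leab HA ltm; rewrite leNgt; apply/negP.
move=> /Thetam_lt[//|//|_ [m' [l [y [lem Hl Hy]]]]].
case: m' => [//|m'] in lem Hl Hy *; rewrite /= in lem.
have [l0 lb Hl'] := Hl.
(* [f] sends a vertex of [A] to the index of its part; outside [A] the value [ord0] is a dummy. *)
have /choice[f Hf] : forall i : 'I_n.+1, exists j : 'I_m'.+1,
    i \in A -> (l j <= i < l j.+1)%N.
  move=> i; have [iA|] := boolP (i \in A); last by exists ord0.
  have [leai _] := HA _ iA.
  have [|||j /andP[_ ltj] /andP[]] := @crossing (fun j => i < l j)%N 0 m'.+1.
  - by [].
  - by rewrite l0 -leqNgt; case/andP: leai.
  - by rewrite lb ltnS; case/andP: leai.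
  by rewrite -leqNgt => lij ltij; exists (Ordinal ltj) => _; rewrite lij.
(* [A] has more members than there are parts, so two of them share a part, to which [Theta_ge]
   applies. *)
have /dinjectivePn[i iA [j /andP[Nij jA] Efij]] : ~~ dinjectiveb f A.
  apply: contraL ltm => /dinjectiveP/leq_card_in.
  by rewrite card_ord -leqNgt => /leq_trans; apply.
have {Nij} : (i < j)%N || (j < i)%N by rewrite -neq_ltn eq_sym.
wlog ltij : i j iA jA Efij / (i < j)%N.
  by move=> W /orP[] lt; [apply: (W i j)|apply: (W j i)]; rewrite ?lt.
move=> _; have [_ wi] := HA _ iA; have [_ wj] := HA _ jA.
have := Hf _ iA; have := Hf _ jA; rewrite -Efij => Hj Hi.
have ltf := ltn_ord (f i); have [_ yf] := Hl' _ ltf.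
have lel : (l (f i).+1 <= b.+1)%N by rewrite -lb; apply: (sinked_partition_le Hl); lia.
have := Hy _ ltf; rewrite ltNge => /negP; apply.
by apply: (@Theta_ge _ _ _ i j) => //; lia.
Qed.

End EvacuationTimes.

(** * The threshold index and the best first cut *)

Theorem theorem5 (R : realType) (n : nat) (P : dynamic_path R n) (k : nat)
    (hk : (1 < k < n)%N)
    (hw : (k.+1 <= #|[set i : 'I_n.+1 | (0 < weight P i)%N]%SET|)%N) :
  exists t : nat,
    [/\ ((t < n)%N /\ Theta1 P 0 t < Thetam P k.-1 t.+1 n) /\
        (forall i, (i < n)%N -> Theta1 P 0 i < Thetam P k.-1 i.+1 n ->
           (i <= t)%N),
        (0 <= t < n)%N,
        (forall i, (i <= t)%N -> Theta1 P 0 i < Thetam P k.-1 i.+1 n),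
        (forall i, (t < i < n)%N -> Thetam P k.-1 i.+1 n <= Theta1 P 0 i) &
        Thetam P k 0 n = Num.min (Theta1 P 0 t.+1) (Thetam P k.-1 t.+1 n)].
Proof.
(* From here on [k] stands for the former [k.-1]. *)
case: k hk hw => // k /andP[k0 ltkn] hw; rewrite /=.
pose Q i := (i < n)%N && (Theta1 P 0 i < Thetam P k i.+1 n).
have n0 : (0 < n)%N by lia.
have Q0 : Q 0%N.
  rewrite /Q n0 /=; apply: (@lt_le_trans _ _ 2^-1).
    (* With the sink at its only vertex, the path [P_(0,0)] is evacuated at time 0. *)
    apply/Theta1_lt => //; exists (vertex P 0); first by rewrite lexx.
    apply/Theta_lt => //; first by rewrite lexx.
    exists 0 => [|i j]; first by rewrite lexx invr_gt0 ltr0n.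
    by rewrite leqn0 => /eqP-> _; apply: Or31.
  (* Of at least [k.+2] vertices with people, dropping vertex 0 leaves more than [k]. *)
  apply: (@Thetam_ge _ _ _ _ _ _ ([set i : 'I_n.+1 | (0 < weight P i)%N] :\ ord0)%SET) => //.
    by rewrite n0 leqnn.
    move=> i; rewrite !inE => /andP[Ni wi]; split=> //.
    by rewrite lt0n Ni -ltnS ltn_ord.
  rewrite -ltnS (leq_trans hw) // [X in (X <= _)%N](cardsD1 ord0).
  by case: (_ \in _); rewrite ?add0n ?add1n.
have [||t /andP[ltn Qt] tmax] := @ex_maxnP Q n; first by exists 0%N.
  by move=> i /andP[/ltnW].
(* The two sides are monotone in [i] in opposite directions. *)
have le_t i : (i <= t)%N -> Theta1 P 0 i < Thetam P k i.+1 n.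
  move=> leit; apply: (@le_lt_trans _ _ (Theta1 P 0 t)).
    by apply: le_Theta1 => //; exact: ltnW.
  by apply: lt_le_trans Qt _; apply: ge_Thetam => //; lia.
have gt_t i : (t < i < n)%N -> Thetam P k i.+1 n <= Theta1 P 0 i.
  move=> /andP[ltti lti]; rewrite leNgt; apply/negP => Hi.
  by have := tmax i; rewrite /Q lti Hi => /(_ isT); rewrite leqNgt ltti.
exists t; split=> //.
  by split=> // i lti Hi; apply: tmax; rewrite /Q lti.
apply/eqP; rewrite eq_le; apply/andP; split.
  rewrite le_min; apply/andP; split.
    (* Cut after [t.+1], where [gt_t] makes the first part the slower one; if [t.+1 = n], the path
       stays undivided. *)
    have := ltn; rewrite leq_eqVlt => /predU1P[->|ltt].
      by apply: Thetam_le1; rewrite ?leqnn.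
    apply: le_trans (Thetam_cons _ _ (i := t.+1) _ _) _ => //.
    by rewrite ge_max lexx gt_t // ltnSn.
  (* Cut after [t], where by [Qt] the rest is the slower one. *)
  apply: le_trans (Thetam_cons _ _ (i := t) _ _) _ => //.
  by rewrite ge_max lexx ltW.
(* A better partition is undivided, or cuts first after some [i]: if [i <= t] its rest is too slow,
   and if [t < i] its first part is. *)
rewrite leNgt; apply/negP => /Thetam_lt_split[//|||].
  by rewrite /= leqnn.
  by rewrite lt_min ltNge le_Theta1.
move=> [i /andP[_ lti] []]; rewrite !lt_min => /andP[lt1 _] /andP[_ lt2].
have [leit|ltti] := leqP i t.
  by move: lt2; rewrite ltNge ge_Thetam // ltnS leit.
by move: lt1; rewrite ltNge le_Theta1 // ltnW.
Qed.
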